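(* For all positive integers $m,n$ the sum of the exponents of the subgroups of $\mathbb{Z}_m\times\mathbb{Z}_n$ (the sum being over all subgroups) is $\sigma(m)\sigma(n)$, where $\sigma(k)=\sum_{d\mid k}d$ is the sum of the positive divisors of $k$.
   Context: $\mathbb{Z}_n$ denotes the cyclic group of order $n$. *)

(* Defs.v *)
From mathcomp Require Import all_boot all_fingroup all_algebra all_solvable.

Set Implicit Arguments.
Unset Strict Implicit.
Unset Printing Implicit Defensive.

Definition sigma (k : nat) : nat := \sum_(d <- divisors k) d.

(* 'Z_1 has two elements, so the cyclic group of order k is taken to be Zp k,
   which is all of 'Z_k for 1 < k and the trivial subgroup for k = 1. *)
Definition ZxZ (m n : nat) : {group 'Z_m * 'Z_n} :=
  [group of setX (Zp m) (Zp n)].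

(* Main.v *)
Require Import Defs.
From mathcomp Require Import all_boot all_fingroup all_algebra all_solvable.

(** Sort the subgroups [H] of [Z_m x Z_n] by their two projections [A] and [B].

    The exponent of [H] depends only on these: it is a multiple of the exponents
    of the images [A] and [B], and the power [lcm] of those two exponents kills
    both coordinates of every element ([exponent_sub_prod]).  Since [A] and [B]
    are cyclic, the exponent of [H] is [lcmn #|A| #|B|].

    The number of [H] with given projections is [gcdn #|A| #|B|]
    ([card_subdirect_cyclic]).  This is Goursat's lemma made explicit: if [x]
    and [y] generate [A] and [B], such an [H] consists of the [(x^i, y^j)] with
    [i = u j] modulo [k], for a common divisor [k] of the two orders and a unit
    [u] modulo [k] ([subdirect_congr]), and for [g = gcdn #|A| #|B|] the pairs
    [(k, u)] correspond to the residues [t = (g / k) u] modulo [g], because [t]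
    determines [g / k = gcdn t g].

    So each pair [(A, B)] contributes [gcdn * lcmn = #|A| * #|B|], and the sum
    over all pairs factors.  A cyclic group has one subgroup of each order
    dividing its own, so the two factors are [sigma m] and [sigma n]. *)

Set Implicit Arguments.
Unset Strict Implicit.
Unset Printing Implicit Defensive.

Local Open Scope group_scope.

Lemma mul_pairg (gT1 gT2 : finGroupType) (x x' : gT1) (y y' : gT2) :
  (x, y) * (x', y') = (x * x', y * y').
Proof. by []. Qed.

Lemma expg_pair (gT1 gT2 : finGroupType) (x : gT1) (y : gT2) n :
  (x, y) ^+ n = (x ^+ n, y ^+ n).
Proof. by elim: n => // n IHn; rewrite !expgS IHn. Qed.

(** Congruences between exponents become membership in a cyclic group, where
    differences of exponents need no truncated subtraction. *)
Lemma mem_cycle_expgB (gT : finGroupType) (x : gT) k i j : (k %| #[x])%N ->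
  (x ^+ i * x ^- j \in <[x ^+ k]>) = (i == j %[mod k])%N.
Proof.
move=> kx; apply/idP/eqP => [/cycleP[s /(canRL (mulgKV _)) /eqP]|Eij].
  rewrite -expgM -expgD eq_expg_mod_order => /eqP Ex.
  by rewrite -(modn_dvdm _ kx) Ex modn_dvdm // mulnC modnMDl.
rewrite (divn_eq i k) (divn_eq j k) Eij !expgD invMg mulgA mulgK.
by rewrite ![(_ * k)%N]mulnC !expgM groupM ?groupV ?mem_cycle.
Qed.

(** The subgroup of all [(x^i, y^j)] with [i = u j] modulo [k], when [k] divides
    the orders of [x] and [y]; see [mem_congr_subgroup].  Giving it by generators
    makes it a group for all [k] and [u], and its projections can be read off. *)
Definition congr_subgroup (gT1 gT2 : finGroupType) (x : gT1) (y : gT2)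
    (k u : nat) : {group gT1 * gT2} :=
  [group of <[(x ^+ u, y)]> <*> <[(x ^+ k, 1)]>].

Lemma mem_congr_subgroup (gT1 gT2 : finGroupType) (x : gT1) (y : gT2) k u i j :
    (k %| #[x])%N -> (k %| #[y])%N ->
  ((x ^+ i, y ^+ j) \in congr_subgroup x y k u) = (i == u * j %[mod k])%N.
Proof.
move=> kx ky; rewrite /= cent_joinEr; last first.
  rewrite cent_cycle cycle_subG; apply/cent1P; rewrite /commute !mul_pairg.
  by rewrite mulg1 mul1g -!expgD addnC.
apply/idP/eqP.
  case/mulsgP=> _ _ /cycleP[r ->] /cycleP[s ->].
  rewrite !expg_pair mul_pairg expg1n mulg1 -!expgM -expgD => -[/eqP + /eqP].
  rewrite !eq_expg_mod_order => /eqP Ex /eqP Ey.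
  have -> : (i = u * r + k * s %[mod k])%N.
    by rewrite -(modn_dvdm _ kx) Ex modn_dvdm.
  have {}Ey : (j = r %[mod k])%N by rewrite -(modn_dvdm _ ky) Ey modn_dvdm.
  by rewrite addnC mulnC modnMDl -modnMmr -Ey modnMmr.
move/eqP; rewrite -(mem_cycle_expgB _ _ kx) => /cycleP[s /(canRL (mulgKV _)) Ei].
apply/mulsgP; exists ((x ^+ u, y) ^+ j) ((x ^+ k, 1) ^+ s); rewrite ?mem_cycle //.
rewrite !expg_pair mul_pairg expg1n mulg1 Ei -!expgM -!expgD.
by rewrite addnC.
Qed.

Definition subdirect (gT1 gT2 : finGroupType) (A : {group gT1})
    (B : {group gT2}) : {set {group gT1 * gT2}} :=
  [set H : {group gT1 * gT2} | ((fst @* H)%G == A) && ((snd @* H)%G == B)].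

Lemma subdirectP (gT1 gT2 : finGroupType) (A : {group gT1}) (B : {group gT2})
    (H : {group gT1 * gT2}) :
  reflect (fst @* H = A /\ snd @* H = B) (H \in subdirect A B).
Proof.
rewrite inE; apply: (iffP andP) => [[/eqP <- /eqP <-] // | [EA EB]].
by split; apply/eqP/val_inj.
Qed.

(** A subgroup that projects into [<[x]>] and [<[y]>] has only elements of the
    form [(x^i, y^j)], so it is determined by a condition on exponents. *)
Lemma eq_subdirect (gT1 gT2 : finGroupType) (x : gT1) (y : gT2)
    (H K : {group gT1 * gT2}) :
    H \in subdirect <[x]>%G <[y]>%G -> K \in subdirect <[x]>%G <[y]>%G ->
    (forall i j, ((x ^+ i, y ^+ j) \in H) = ((x ^+ i, y ^+ j) \in K)) ->
  H = K.
Proof.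
suff sub (L M : {group gT1 * gT2}) : L \in subdirect <[x]>%G <[y]>%G ->
    (forall i j, ((x ^+ i, y ^+ j) \in L) = ((x ^+ i, y ^+ j) \in M)) ->
  L \subset M.
  move=> dH dK E; apply/val_inj/eqP.
  by rewrite eqEsubset; apply/andP; split; apply: sub => // i j; rewrite E.
move=> /subdirectP[Lx Ly] E; apply/subsetP=> -[a b] Lab.
have: a \in <[x]> by rewrite -Lx; apply: (mem_morphim _ (in_setT _) Lab).
have: b \in <[y]> by rewrite -Ly; apply: (mem_morphim _ (in_setT _) Lab).
by case/cycleP=> j Ej /cycleP[i Ei]; move: Lab; rewrite Ei Ej E.
Qed.

(** The second projection is full because of the generator [(x^u, y)].  For the
    first one [u] must be invertible modulo [k]. *)
Lemma congr_subgroup_subdirect (gT1 gT2 : finGroupType) (x : gT1) (y : gT2)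
    k u : (k %| #[x])%N -> (k %| #[y])%N -> coprime u k ->
  congr_subgroup x y k u \in subdirect <[x]>%G <[y]>%G.
Proof.
move=> kx ky cuk; apply/subdirectP.
have k_gt0 : (0 < k)%N by apply: dvdn_gt0 kx; apply: order_gt0.
split; rewrite /= morphimY ?subsetT // !morphim_cycle ?inE //=.
  apply/eqP; rewrite eqEsubset join_subG !cycle_subG !mem_cycle /=.
  (* By Euler's theorem this power is an inverse of u modulo k. *)
  set j := (u ^ (totient k).-1)%N.
  have Ej : (1 == u * j %[mod k])%N.
    by rewrite -expnS prednK ?totient_gt0 // Euler_exp_totient.
  rewrite -(@mem_congr_subgroup _ _ x y _ _ 1 j) // in Ej.
  have := mem_morphim [morphism of fst] (in_setT _) Ej.
  by rewrite /= morphimY ?subsetT // !morphim_cycle ?inE.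
by rewrite cycle1 joingG1.
Qed.

(** Goursat's lemma for cyclic factors.  The elements [z] with [(z, 1)] in [H]
    form a subgroup [<[x ^+ k]>] of [<[x]>], and any element [(x^u, y)] of [H]
    reduces membership of [(x^i, y^j)] to membership of [(x^(i - u j), 1)].
    Then fullness of the first projection makes [u] a unit modulo [k], and as
    [y ^+ #[y] = 1] gives [k %| u * #[y]], also [k] divides [#[y]]. *)
Lemma subdirect_congr (gT1 gT2 : finGroupType) (x : gT1) (y : gT2)
    (H : {group gT1 * gT2}) :
    H \in subdirect <[x]>%G <[y]>%G ->
  exists k u, [/\ (k %| #[x])%N, (k %| #[y])%N, coprime u k
    & H = congr_subgroup x y k u].
Proof.
move=> dH; have /subdirectP[Hx Hy] := dH.
pose K := (<[x]> :&: (pairg1 gT2 @*^-1 H))%G.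
have memK z : (z \in K) = (z \in <[x]>) && ((z, 1) \in H).
  by rewrite !inE.
have [k kx EK] : exists2 k, (k %| #[x])%N & K :=: <[x ^+ k]>.
  have := cardSg (subsetIl <[x]> (pairg1 gT2 @*^-1 H)).
  rewrite -/(gval K) => dvdK; exists (#[x] %/ #|K|)%N; first exact: dvdn_div.
  have /setP/(_ K) := cycle_sub_group dvdK.
  by rewrite !inE eqxx subsetIl => /esym/eqP {1}->.
have [u Hu] : exists u, (x ^+ u, y) \in H.
  have: y \in snd @* H by rewrite Hy cycle_id.
  case/morphimP=> -[a b] _ Hab /= Eb; subst b.
  have: a \in fst @* H by apply: (mem_morphim _ (in_setT _) Hab).
  by rewrite Hx => /cycleP[u Ea]; exists u; rewrite -Ea.
have memH i j : ((x ^+ i, y ^+ j) \in H) = (i == u * j %[mod k])%N.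
  have := groupX j Hu; rewrite expg_pair -expgM => Huj.
  rewrite -(groupMr _ (groupVr Huj)).
  have -> : (x ^+ (u * j), y ^+ j)^-1 = (x ^- (u * j), y ^- j) by [].
  rewrite mul_pairg mulgV.
  by rewrite -(mem_cycle_expgB _ _ kx) -EK memK groupM ?groupV ?mem_cycle.
have cuk : coprime u k.
  have: x \in fst @* H by rewrite Hx cycle_id.
  case/morphimP=> -[a b] _ Hab /= Ea; subst a.
  have: b \in snd @* H by apply: (mem_morphim _ (in_setT _) Hab).
  rewrite Hy => /cycleP[j Eb]; move: Hab; rewrite Eb (memH 1%N) => /eqP E1.
  have := coprime1n k; rewrite -coprime_modl E1.
  by rewrite coprime_modl coprimeMl => /andP[].
have ky : (k %| #[y])%N.
  have: (x ^+ 0, y ^+ #[y]) \in H by rewrite expg_order group1.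
  by rewrite memH mod0n eq_sym -/(dvdn k _) Gauss_dvdr // coprime_sym.
exists k, u; split=> //; apply: (@eq_subdirect _ _ x y) => //.
  exact: congr_subgroup_subdirect.
by move=> i j; rewrite memH mem_congr_subgroup.
Qed.

(** The residue [t < g] encodes the modulus [k = g / gcdn t g] and the unit
    [u = t / gcdn t g] modulo [k]: this is the fraction [t / g] in lowest terms,
    so every pair of a divisor [k] of [g] and a unit modulo [k] arises once. *)
Lemma card_subdirect_cyclic (gT1 gT2 : finGroupType) (A : {group gT1})
    (B : {group gT2}) :
  cyclic A -> cyclic B -> #|subdirect A B| = gcdn #|A| #|B|.
Proof.
case/cyclicP=> x EA /cyclicP[y EB].
have {EA}-> : A = <[x]>%G by apply: val_inj.
have {EB}-> : B = <[y]>%G by apply: val_inj.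
rewrite -!orderE; set g := gcdn _ _.
have g_gt0 : (0 < g)%N by rewrite gcdn_gt0 order_gt0.
have divgK d : (d %| g)%N -> (g %/ (g %/ d) = d)%N.
  by move=> dg; rewrite divnA // mulKn.
pose f (t : 'I_g) := congr_subgroup x y (g %/ gcdn t g) (t %/ gcdn t g).
have h_gt0 (t : 'I_g) : (0 < gcdn t g)%N by rewrite gcdn_gt0 g_gt0 orbT.
have kg (t : 'I_g) : (g %/ gcdn t g %| g)%N by apply: dvdn_div; apply: dvdn_gcdr.
have kx (t : 'I_g) : (g %/ gcdn t g %| #[x])%N.
  by apply: dvdn_trans (kg t) _; apply: dvdn_gcdl.
have ky (t : 'I_g) : (g %/ gcdn t g %| #[y])%N.
  by apply: dvdn_trans (kg t) _; apply: dvdn_gcdr.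
have cuk (t : 'I_g) : coprime (t %/ gcdn t g) (g %/ gcdn t g).
  rewrite /coprime -(eqn_pmul2r (h_gt0 t)) muln_gcdl.
  by rewrite !divnK ?dvdn_gcdl ?dvdn_gcdr // mul1n.
suff -> : subdirect <[x]>%G <[y]>%G = [set f t | t in 'I_g].
  rewrite card_in_imset ?card_ord // => t t' _ _ Eff.
  (* The modulus is recovered from the group as the least positive i with
     (x^i, 1) in it, and then the unit from the element (x^u, y). *)
  have sub (s s' : 'I_g) : f s = f s' ->
      (g %/ gcdn s' g %| g %/ gcdn s g)%N.
    move=> E.
    have: (x ^+ (g %/ gcdn s g), y ^+ 0) \in f s.
      by rewrite mem_congr_subgroup // muln0 modnn mod0n.
    by rewrite E mem_congr_subgroup // muln0 mod0n.
  have Ek : (g %/ gcdn t g = g %/ gcdn t' g)%N.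
    by apply/eqP; rewrite eqn_dvd !sub.
  have Eh : gcdn t g = gcdn t' g.
    by rewrite -[LHS]divgK ?dvdn_gcdr // Ek divgK ?dvdn_gcdr.
  have: (x ^+ (t %/ gcdn t g), y ^+ 1) \in f t.
    by rewrite mem_congr_subgroup // muln1.
  rewrite Eff mem_congr_subgroup // muln1 -Ek -Eh.
  rewrite !modn_small ?ltn_divLR ?divnK ?dvdn_gcdr ?ltn_ord // => /eqP E.
  apply: val_inj; rewrite /= -[LHS](divnK (dvdn_gcdl t g)) E.
  by rewrite divnK // Eh dvdn_gcdl.
apply/setP=> H; apply/idP/imsetP => [/subdirect_congr|[t _ ->]]; last first.
  exact: congr_subgroup_subdirect.
case=> k [u [kx' ky' cuk' EH]].
have k_gt0 : (0 < k)%N by apply: dvdn_gt0 kx'; apply: order_gt0.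
have kg' : (k %| g)%N by rewrite dvdn_gcd kx'.
have h0 : (0 < g %/ k)%N by rewrite divn_gt0 // dvdn_leq.
have lt_t : (g %/ k * (u %% k) < g)%N.
  by rewrite -{2}(divnK kg') ltn_pmul2l // ltn_mod.
have Eh : gcdn (g %/ k * (u %% k)) g = (g %/ k)%N.
  rewrite -{2}(divnK kg') -muln_gcdr gcdn_modl.
  by rewrite (eqP cuk') muln1.
exists (Ordinal lt_t) => //.
apply: (@eq_subdirect _ _ x y).
- by rewrite EH congr_subgroup_subdirect.
- exact: congr_subgroup_subdirect.
move=> i j; rewrite EH !mem_congr_subgroup //= Eh divgK // mulKn //.
by rewrite modnMml.
Qed.

(** Holds for every subgroup of a product: a power of a pair is trivial exactly
    when both coordinates are. *)
Lemma exponent_sub_prod (gT1 gT2 : finGroupType) (H : {group gT1 * gT2}) :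
  exponent H = lcmn (exponent (fst @* H)) (exponent (snd @* H)).
Proof.
apply/eqP; rewrite eqn_dvd dvdn_lcm !exponent_morphim !andbT.
apply/exponentP=> -[a b] Hab; rewrite expg_pair; congr (_, _).
  apply/eqP; rewrite -order_dvdn; apply: dvdn_trans (dvdn_lcml _ _).
  by apply: dvdn_exponent; apply: (mem_morphim _ (in_setT _) Hab).
apply/eqP; rewrite -order_dvdn; apply: dvdn_trans (dvdn_lcmr _ _).
by apply: dvdn_exponent; apply: (mem_morphim _ (in_setT _) Hab).
Qed.

(** In a cyclic group, the order is a bijection from subgroups to divisors. *)
Lemma sum_card_subgroups_cyclic (gT : finGroupType) (G : {group gT}) :
  cyclic G -> (\sum_(H in subgroups G) #|H|)%N = sigma #|G|.
Proof.
move=> cG; rewrite /sigma -big_enum.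
rewrite -(big_map (fun H : {group gT} => #|H|) xpredT id) /=.
apply: perm_big; apply: uniq_perm.
- rewrite map_inj_in_uniq ?enum_uniq // => H K.
  rewrite !mem_enum !inE => sH sK E.
  by apply/val_inj/eqP; rewrite /= (eq_subG_cyclic cG) // E.
- exact: divisors_uniq.
move=> d; rewrite -dvdn_divisors ?cardG_gt0 //; apply/mapP/idP.
  by case=> H; rewrite mem_enum inE => /cardSg + ->.
have /cyclicP[x Gx] := cG; rewrite Gx -orderE => dx.
have /setP/(_ <[x ^+ (#[x] %/ d)]>%G) := cycle_sub_group dx.
rewrite !inE eqxx => /andP[sH /eqP cH]; exists <[x ^+ (#[x] %/ d)]>%G => //.
by rewrite mem_enum inE.
Qed.

(** Each pair of projections [(A, B)] contributes [#|A| * #|B|], as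
    [gcdn a b * lcmn a b = a * b]. *)
Lemma sum_exponent_subgroups_setX (gT1 gT2 : finGroupType)
    (G1 : {group gT1}) (G2 : {group gT2}) :
    cyclic G1 -> cyclic G2 ->
  (\sum_(H in subgroups (setX G1 G2)) exponent H = sigma #|G1| * sigma #|G2|)%N.
Proof.
move=> c1 c2; rewrite -!sum_card_subgroups_cyclic // big_distrlr /=.
rewrite pair_big /=.
pose projs (H : {group gT1 * gT2}) := ((fst @* H)%G, (snd @* H)%G).
rewrite (partition_big projs (fun p : {group gT1} * {group gT2} =>
  (p.1 \in subgroups G1) && (p.2 \in subgroups G2))) /=; last first.
  move=> H; rewrite !inE => sH.
  have := morphimS [morphism of fst] sH; have := morphimS [morphism of snd] sH.
  by rewrite morphim_fstX morphim_sndX => -> ->.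
apply: eq_bigr => -[A B] /=; rewrite !inE => /andP[sA sB].
rewrite (eq_bigl (mem (subdirect A B))) => [|H]; last first.
  rewrite !inE xpair_eqE andbC; apply: andb_idr => /andP[/eqP EA /eqP EB].
  apply/subsetP=> -[a b] Hab; rewrite inE /=.
  rewrite (subsetP sA) ?(subsetP sB) // -?EA -?EB;
    exact: (mem_morphim _ (in_setT _) Hab).
rewrite (eq_bigr (fun=> lcmn #|A| #|B|)) => [|H /subdirectP[EA EB]]; last first.
  by rewrite exponent_sub_prod EA EB !exponent_cyclic ?(cyclicS sA) ?(cyclicS sB).
rewrite sum_nat_const card_subdirect_cyclic ?(cyclicS sA) ?(cyclicS sB) //.
by rewrite mulnC muln_lcm_gcd.
Qed.

Lemma Zp_cyclic n : cyclic (Zp n).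
Proof.
apply: cyclicS (subsetT _) _.
by apply/cyclicP; exists Zp1; apply: Zp_cycle.
Qed.

Local Close Scope group_scope.

Theorem proposition3p2 (m n : nat) (m_gt0 : 0 < m) (n_gt0 : 0 < n) :
  \sum_(H in subgroups (ZxZ m n)) exponent H = sigma m * sigma n.
Proof.
by rewrite sum_exponent_subgroups_setX ?Zp_cyclic // !card_Zp.
Qed.
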